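(* Let $B$ be the $\mathbb N$-infinite Pascal-Bratteli diagram. For a probability vector $\overline d=\langle d_i: i=1,2,\ldots\rangle$ (i.e. $d_i\ge0$, $\sum_{i}d_i=1$), let $\mu_{\overline d}$ be the tail invariant probability measure on the path space $X_B$ whose value on the cylinder set of any finite path from $V_1$ to a vertex $\overline s=(s_1,s_2,\ldots)\in V_n$ is $\prod_{i}d_i^{s_i}$. Then the measures $\mu_{\overline d}$, where $\overline d$ runs over all probability vectors, form the set of all ergodic tail invariant probability measures on $X_B$.
   Context: The $\mathbb N$-infinite Pascal-Bratteli diagram has levels $V_n=\{\overline s=(s_1,s_2,\ldots): s_i\in\mathbb Z_{\ge0},\ \sum_{i\ge1}s_i=n\}$, $n\in\mathbb N=\{1,2,\ldots\}$. There is exactly one edge between $\overline s\in V_n$ (source) and $\overline t\in V_{n+1}$ (range) if $\overline t=\overline s+\overline e^{(i)}$ for some $i\in\mathbb N$, where $\overline e^{(i)}$ is the $i$-th standard basis vector, and no edge otherwise. The path space $X_B$ is the set of infinite paths starting at $V_1$, equivalently sequences $(\overline s^{(1)},\overline s^{(2)},\ldots)$ with $\overline s^{(n)}\in V_n$ and consecutive vertices joined by an edge, with topology generated by cylinder sets (sets of all infinite paths with a prescribed finite initial path; a path of length $0$ is a vertex of $V_1$). Convention: $0^0=1$. Two infinite paths are tail equivalent if they coincide from some level on. A Borel measure on $X_B$ is tail invariant if it takes equal values on cylinder sets of finite paths (starting in $V_1$) with the same terminal vertex; a tail invariant probability measure is ergodic if every Borel set that is a union of tail equivalence classes has measure $0$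 or $1$. *)

(* Defs.v *)
From HB Require Import structures.
From mathcomp Require Import all_boot all_order all_algebra finmap.
From mathcomp Require Import all_classical all_reals all_analysis.

Set Implicit Arguments.
Unset Strict Implicit.
Unset Printing Implicit Defensive.

Import Order.TTheory GRing.Theory Num.Theory.

Local Open Scope classical_set_scope.
Local Open Scope ring_scope.

(* Coordinates are indexed from 0: coordinate i stands for s_(i+1). A sequence
   of nonnegative integers with finite sum is exactly a finitely supported one,
   so the vertices of all levels together form the type below. *)
Definition vertex := {fsfun nat -> nat with 0%N}.

(* V_n is the set of vertices s with level s = n. *)
Definition level (s : vertex) : nat := (\sum_(i <- finsupp s) s i)%N.

(* t = s + e^(i) for some i; then level t = (level s).+1. Since there is at most
   one edge between two vertices, a path is the sequence of its vertices. *)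
Definition edge : rel vertex :=
  fun s t => `[< exists i : nat, forall j : nat, t j = (s j + (j == i))%N >].

(* The path v :: p; its terminal vertex is last v p, of level (size p).+1. *)
Definition finite_path (v : vertex) (p : seq vertex) : Prop :=
  level v = 1%N /\ path edge v p.

(* The paths x are indexed from 0: x n belongs to V_(n+1). *)
Record path_space := PathSpace {
  path_vertex :> nat -> vertex;
  path_start : level (path_vertex 0%N) = 1%N;
  path_edge : forall n, edge (path_vertex n) (path_vertex n.+1)
}.

Definition cylinder (v : vertex) (p : seq vertex) : set path_space :=
  [set x | forall i, (i <= size p)%N -> x i = nth v (v :: p) i].

Definition cylinders : set (set path_space) :=
  [set C | exists v p, finite_path v p /\ C = cylinder v p].

HB.instance Definition _ := gen_eqMixin path_space.
HB.instance Definition _ := gen_choiceMixin path_space.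

Definition point_vertex (n : nat) : vertex :=
  [fsfun i in [fset 0%N]%fset => n.+1 | 0%N].

Lemma point_vertexE n i : point_vertex n i = if i == 0%N then n.+1 else 0%N.
Proof. by rewrite fsfunE inE. Qed.

Lemma point_path_start : level (point_vertex 0) = 1%N.
Proof.
rewrite /level; have -> : finsupp (point_vertex 0) = [fset 0%N]%fset.
  apply/fsetP => i; rewrite mem_finsupp point_vertexE in_fset1.
  by case: (i == 0%N).
by rewrite big_seq_fset1 point_vertexE.
Qed.

Lemma point_path_edge n : edge (point_vertex n) (point_vertex n.+1).
Proof.
apply/asboolP; exists 0%N => j; rewrite !point_vertexE.
by case: eqP => // _; rewrite addn1.
Qed.

HB.instance Definition _ :=
  isPointed.Build path_space (PathSpace point_path_start point_path_edge).

HB.instance Definition _ := isSubBaseTopological.Build path_space cylinders id.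

(* path_space with its Borel sigma-algebra *)
Definition borel_path_space := g_sigma_algebraType (@open path_space).
HB.instance Definition _ := Measurable.on borel_path_space.

Definition tail_equivalent (x y : path_space) : Prop :=
  exists N : nat, forall n, (N <= n)%N -> x n = y n.

(* A is a union of tail equivalence classes. *)
Definition tail_saturated (A : set path_space) : Prop :=
  forall x y, tail_equivalent x y -> A x -> A y.

Definition tail_invariant (R : realType)
    (mu : probability borel_path_space R) : Prop :=
  forall v p w q, finite_path v p -> finite_path w q -> last v p = last w q ->
    mu (cylinder v p) = mu (cylinder w q).

Definition ergodic (R : realType)
    (mu : probability borel_path_space R) : Prop :=
  forall A : set borel_path_space, measurable A -> tail_saturated A ->
    mu A = 0%E \/ mu A = 1%E.

Definition probability_vector (R : realType) (d : nat -> R) : Prop :=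
  (forall i, 0 <= d i) /\ (\sum_(0 <= i <oo) (d i)%:E = 1)%E.

(* The product of d_i ^ s_i over all i: the factors outside the support of s
   are d_i ^ 0 = 1, also when d_i = 0. *)
Definition vertex_weight (R : realType) (d : nat -> R) (s : vertex) : R :=
  \prod_(i <- finsupp s) d i ^+ s i.

(* mu is the measure mu_d, up to its values on non-measurable sets *)
Definition is_mu (R : realType) (d : nat -> R)
    (mu : probability borel_path_space R) : Prop :=
  tail_invariant mu /\
  forall v p, finite_path v p ->
    mu (cylinder v p) = (vertex_weight d (last v p))%:E.

(* Main.v *)
Require Import Defs.
From HB Require Import structures.
From mathcomp Require Import all_boot all_order all_algebra finmap.
From mathcomp Require Import all_classical all_reals all_analysis.
From mathcomp Require Import ring lra.

Set Implicit Arguments.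
Unset Strict Implicit.
Unset Printing Implicit Defensive.

Import Order.TTheory GRing.Theory Num.Theory.

Local Open Scope classical_set_scope.
Local Open Scope ring_scope.

(** A path is determined by the sequence of the coordinates that it increases,
    its letters, and every sequence of natural numbers arises in this way. A
    cylinder becomes the set of paths whose letters start with a given word, and
    its terminal vertex counts the occurrences of each letter in that word. So a
    tail invariant measure is an exchangeable one (permuting a word does not
    change its measure), [mu_d] is the law of independent letters with common
    distribution [d], and the theorem combines the theorems of de Finetti and of
    Hewitt and Savage. Both halves below rely on one construction: if [m] is
    exchangeable and [u] is a word, the law [after m u] of the letters that
    follow [u] is exchangeable, and it depends on [u] only up to permutation.

    Existence of [mu_d]: cut the unit interval into consecutive intervals of
    lengths [d 0], [d 1], ..., and cut each of them again in the same
    proportions, forever. The point [u] is sent to the sequence of the indices of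
    the intervals containing it, and the points that start with the word [w] form
    an interval whose length is the product of the [d i] over [w]. The image of
    the Lebesgue measure is therefore [mu_d] ([product_measure_exists]).
    Uniqueness holds because word sets, with the empty set, form a pi-system
    that generates the Borel sets ([measure_eq_words]).

    An ergodic exchangeable [nu] is some [mu_d]: the measure [after nu [:: i]] is
    at most [nu], because [nu] is shift invariant, so it suffices to see that it
    is a multiple of [nu] ([ergodic_proportional]). For the constant [c] that
    gives both sides the same total mass, take a Hahn decomposition of the
    difference [after nu [:: i] - c nu]. This charge does not change when a prefix
    is exchanged for one of its permutations, hence the saturation of its
    negative set is still negative. By ergodicity this saturation is null or of
    full measure, so the charge has a constant sign, and having total mass zero
    it vanishes. Induction on words then gives the product formula.

    Conversely [mu_d] is ergodic ([product_ergodic]): let [A] be Borel and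
    saturated. The restrictions of [mu_d] to [A] and to its complement are
    exchangeable and sum to [mu_d]. For an exchangeable [m], integrating the
    square of (number of [i] among the first [n] letters) [- n t] and letting [n]
    grow shows that [m(ii) - 2 t m(i) + t^2 m(X) >= 0] for all [t]. For [mu_d]
    this vanishes at [t = d i]; hence it does for both restrictions, and this
    forces [m(i) = d i * m(X)]. Induction on words shows that [A] is independent
    of all word sets, hence of itself, so [mu_d A] is [0] or [1]. *)

(** * Paths as sequences of letters *)

Definition count_vertex (w : seq nat) : vertex :=
  [fsfun i in seq_fset tt w => count_mem i w | 0%N].

Lemma count_vertexE w i : count_vertex w i = count_mem i w.
Proof.
rewrite fsfunE seq_fsetE; case: ifPn => // iw.
by rewrite (count_memPn iw).
Qed.

Lemma count_vertex_perm u v : perm_eq u v <-> count_vertex u = count_vertex v.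
Proof.
split=> [/permP uv|uv].
  by apply/fsfunP => i; rewrite !count_vertexE uv.
by apply/allP => i _ /=; rewrite -!count_vertexE uv.
Qed.

Lemma edge_count_vertex w t :
  edge (count_vertex w) t <-> exists i, t = count_vertex (rcons w i).
Proof.
split=> [/asboolP [i ti]|[i ->]].
  exists i; apply/fsfunP => j.
  rewrite ti !count_vertexE -cats1 count_cat /= addn0.
  by congr (_ + nat_of_bool _)%N; rewrite eq_sym.
apply/asboolP; exists i => j.
rewrite !count_vertexE -cats1 count_cat /= addn0.
by congr (_ + nat_of_bool _)%N; rewrite eq_sym.
Qed.

Lemma level_count_vertex1 i : level (count_vertex [:: i]) = 1%N.
Proof.
rewrite /level; have -> : finsupp (count_vertex [:: i]) = [fset i]%fset.
  apply/fsetP => j; rewrite mem_finsupp count_vertexE in_fset1 /= addn0.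
  rewrite [j == i]eq_sym.
  by case: (i == j).
by rewrite big_seq_fset1 count_vertexE /= eqxx.
Qed.

Lemma level1_count_vertex s :
  level s = 1%N -> exists i, s = count_vertex [:: i].
Proof.
rewrite /level => s1.
have [i si] : exists i, i \in finsupp s.
  have [s0|[i si]] := fset_0Vmem (finsupp s); last by exists i.
  by move: s1; rewrite s0 big_seq_fset0.
exists i; apply/fsfunP => j; rewrite count_vertexE /= addn0.
have : (0 < s i)%N by rewrite lt0n -mem_finsupp.
move: s1; rewrite (big_fsetD1 i) //= => s1 si0.
have [<-|ij] := eqVneq i j; first by move: s1 si0; case: (s i) => [|[|n]].
case jn : (j \in finsupp s); last by rewrite fsfun_dflt ?jn.
move: s1; rewrite (big_fsetD1 j) /=; last by rewrite in_fsetD1 jn eq_sym ij.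
by case: (s i) si0 => [|[|n]] // _; case: (s j).
Qed.

(** The letter chosen at time [n] is the unique coordinate in which the path
    increases when it reaches level [n + 1]. *)
Definition letter (x : path_space) (n : nat) : nat :=
  if n is k.+1 then xget 0%N [set i | forall j, x k.+1 j = (x k j + (j == i))%N]
  else xget 0%N [set i | x 0%N = count_vertex [:: i]].

Lemma path_letter (x : path_space) n :
  x n = count_vertex (mkseq (letter x) n.+1).
Proof.
elim: n => [|n IHn].
  rewrite /mkseq /= /letter; case: xgetP => // noi.
  by have [i /noi] := level1_count_vertex (path_start x).
have /asboolP [i xi] := path_edge x n.
have lx : forall j, x n.+1 j = (x n j + (j == letter x n.+1))%N.
  by rewrite /letter; case: xgetP => [_ _ //|noi]; have := noi i xi.
apply/fsfunP => j.
rewrite lx IHn !count_vertexE [mkseq _ n.+2]mkseqS -cats1 count_cat /= addn0.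
by congr (_ + nat_of_bool _)%N; rewrite eq_sym.
Qed.

Lemma of_letters_start (a : nat -> nat) :
  level (count_vertex (mkseq a 1)) = 1%N.
Proof. exact: level_count_vertex1. Qed.

Lemma of_letters_edge (a : nat -> nat) n :
  edge (count_vertex (mkseq a n.+1)) (count_vertex (mkseq a n.+2)).
Proof. by apply/edge_count_vertex; exists (a n.+1); rewrite mkseqS. Qed.

Definition of_letters (a : nat -> nat) : path_space :=
  PathSpace (of_letters_start a) (of_letters_edge a).

Lemma path_space_inj (x y : path_space) : (forall n, x n = y n) -> x = y.
Proof.
case: x => x x0 xe; case: y => y y0 ye /= xy.
have {}xy : x = y by apply/funext.
by subst y; congr PathSpace; exact: Prop_irrelevance.
Qed.

Lemma letterK x : of_letters (letter x) = x.
Proof. by apply: path_space_inj => n; rewrite [RHS]path_letter. Qed.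

Lemma count_vertex_rcons_inj u v i j : count_vertex u = count_vertex v ->
  count_vertex (rcons u i) = count_vertex (rcons v j) -> i = j.
Proof.
move=> /count_vertex_perm uv /count_vertex_perm.
rewrite -!cats1 => uivj.
have := perm_cat uv (perm_refl [:: i]).
rewrite perm_sym => /perm_trans /(_ uivj); rewrite perm_cat2l.
by move=> /perm_mem /(_ i); rewrite !inE eqxx => /esym/eqP.
Qed.

(** A word is determined by the vertices that it visits. *)
Lemma prefix_count_vertex_inj u v : size u = size v ->
  (forall k, (k < size u)%N ->
     count_vertex (take k.+1 u) = count_vertex (take k.+1 v)) -> u = v.
Proof.
elim/last_ind: u v => [|u i IH] v; first by case: v.
case/lastP: v => [|v j]; first by rewrite size_rcons.
rewrite !size_rcons => -[suv] h.
have uv : u = v.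
  apply: IH => // k ku; have := h k (ltnW ku).
  by rewrite -!cats1 !takel_cat // -suv.
congr rcons => //; have := h (size u) (ltnSn _).
rewrite !take_oversize ?size_rcons ?suv // -uv.
exact: count_vertex_rcons_inj.
Qed.

Lemma of_lettersK a n : letter (of_letters a) n = a n.
Proof.
have /= E k := path_letter (of_letters a) k.
have : mkseq (letter (of_letters a)) n.+1 = mkseq a n.+1.
  apply: prefix_count_vertex_inj; rewrite !size_mkseq // => k kn.
  rewrite /mkseq -!map_take !take_iota.
  have /minn_idPl -> : (k.+1 <= n.+1)%N by [].
  by rewrite -![map _ _]/(mkseq _ _) -E.
move/(congr1 (fun s => nth 0%N s n)); rewrite !nth_mkseq //.
Qed.

Definition word_set (w : seq nat) : set path_space :=
  [set x | mkseq (letter x) (size w) = w].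

Lemma word_setP w x :
  word_set w x <-> forall k, (k < size w)%N -> letter x k = nth 0%N w k.
Proof.
split=> [/= <- k|h /=]; first by rewrite size_mkseq => kw; rewrite nth_mkseq.
apply: (@eq_from_nth _ 0%N); rewrite size_mkseq // => k kw.
by rewrite nth_mkseq // h.
Qed.

Lemma word_set_nil : word_set [::] = setT.
Proof. by apply/seteqP; split. Qed.

Lemma take_mkseq (a : nat -> nat) n k : (k <= n)%N ->
  take k (mkseq a n) = mkseq a k.
Proof.
by move=> kn; rewrite /mkseq -map_take take_iota; move/minn_idPl : kn => ->.
Qed.

Lemma cylinder_word v p w : size w = (size p).+1 ->
  (forall k, (k <= size p)%N -> nth v (v :: p) k = count_vertex (take k.+1 w)) ->
  cylinder v p = word_set w.
Proof.
move=> sw h; apply/seteqP; split=> x.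
  move=> xc; apply: prefix_count_vertex_inj; rewrite size_mkseq // => k kw.
  by rewrite take_mkseq // -path_letter xc -?h // -ltnS -sw.
move=> /= xw k kp; rewrite h // -xw path_letter take_mkseq //.
by rewrite sw.
Qed.

Lemma finite_path_word v p : finite_path v p ->
  exists w, [/\ (0 < size w)%N, cylinder v p = word_set w &
    last v p = count_vertex w].
Proof.
move=> vp.
have [w [sw wh]] : exists w, size w = (size p).+1 /\
    forall k, (k <= size p)%N -> nth v (v :: p) k = count_vertex (take k.+1 w).
  case: vp => v1; elim/last_ind: p => [_|p t IH].
    have [i ->] := level1_count_vertex v1.
    by exists [:: i]; split=> // -[].
  rewrite rcons_path => /andP [/IH [w [sw wh]] e].
  have lw : last v p = count_vertex w.
    by rewrite (last_nth v) wh // -sw take_size.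
  move: e; rewrite lw => /edge_count_vertex [i ti].
  exists (rcons w i); rewrite !size_rcons sw; split=> // k.
  rewrite leq_eqVlt => /orP [/eqP ->|].
    by rewrite /= nth_rcons ltnn eqxx take_oversize ?size_rcons ?sw.
  rewrite ltnS => kp; rewrite -[rcons w i]cats1 takel_cat ?sw // -wh //.
  by rewrite -rcons_cons nth_rcons /= ltnS kp.
exists w; split; [by rewrite sw|exact: cylinder_word|].
by rewrite (last_nth v) wh // -sw take_size.
Qed.

Lemma word_finite_path w : (0 < size w)%N ->
  exists v p, [/\ finite_path v p, cylinder v p = word_set w &
    last v p = count_vertex w].
Proof.
move=> w0.
suff [v [p [vp sw wh]]] : exists v p, [/\ finite_path v p, size w = (size p).+1 &
    forall k, (k <= size p)%N -> nth v (v :: p) k = count_vertex (take k.+1 w)].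
  exists v, p; split=> //; first exact: cylinder_word.
  by rewrite (last_nth v) wh // -sw take_size.
elim/last_ind: w w0 => // w i IH _.
case: (posnP (size w)) => [/size0nil ->|/IH [v [p [[v1 vp] sw wh]]]].
  exists (count_vertex [:: i]), [::]; split=> //; last by case.
  by split=> //; exact: level_count_vertex1.
exists v, (rcons p (count_vertex (rcons w i))).
rewrite !size_rcons sw; split=> //; first split=> //.
  rewrite rcons_path vp (last_nth v) wh // -sw take_size /=.
  by apply/edge_count_vertex; exists i.
move=> k; rewrite leq_eqVlt => /orP [/eqP ->|].
  by rewrite /= nth_rcons ltnn eqxx take_oversize ?size_rcons ?sw.
rewrite ltnS => kp; rewrite -[rcons w i]cats1 takel_cat ?sw // -wh //.
by rewrite -rcons_cons nth_rcons /= ltnS kp.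
Qed.

(** * The Borel sets of the path space *)

Lemma word_set_take w n : word_set w `<=` word_set (take n w).
Proof.
move=> x /word_setP xw; apply/word_setP => k.
rewrite size_take_min leq_min => /andP [kn kw].
by rewrite nth_take // xw.
Qed.

Lemma word_set_prefix x n m : (n <= m)%N ->
  word_set (mkseq (letter x) m) `<=` word_set (mkseq (letter x) n).
Proof. by move=> nm; rewrite -(take_mkseq _ nm); exact: word_set_take. Qed.

Lemma word_set_mkseq x n : word_set (mkseq (letter x) n) x.
Proof. by rewrite /word_set /= size_mkseq. Qed.

Lemma open_word_set w : open (word_set w).
Proof.
case: (posnP (size w)) => [/size0nil ->|w0].
  by rewrite word_set_nil; exact: openT.
have [v [p [vp <- _]]] := word_finite_path w0.
exists [set cylinder v p]; last by rewrite bigcup_set1.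
by move=> _ ->; apply: finI_from1; exists v, p.
Qed.

Lemma open_word_nbhs (O : set path_space) x : open O -> O x ->
  exists n, word_set (mkseq (letter x) n) `<=` O.
Proof.
move=> [D' D'b <-] [B D'B Bx].
have [F Fc FB] := D'b _ D'B.
have Fx C : C \in F -> C x by move=> CF; move: Bx; rewrite -FB; exact.
have /choice [f fP] : forall C, exists n, C \in F ->
    word_set (mkseq (letter x) n) `<=` C.
  move=> C; case CF: (C \in F); last by exists 0%N.
  have /Fc := CF; rewrite inE => -[v [p [vp CE]]].
  have [w [_ cw _]] := finite_path_word vp.
  exists (size w) => _; have := Fx _ CF.
  by rewrite CE cw => xw; rewrite (xw : mkseq _ _ = w).
exists (\max_(C <- F) f C)%N => y yx.
exists B; first exact: D'B.
suff: B y by []; rewrite -FB => C CF.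
apply: (fP C CF); apply: word_set_prefix yx.
exact: leq_bigmax_seq.
Qed.

Lemma measurable_word_set w :
  measurable (word_set w : set borel_path_space).
Proof. by apply: sub_sigma_algebra; exact: open_word_set. Qed.

(** There are only countably many words, so a set that contains a neighbourhood
    of each of its points is a countable union of word sets. *)
Lemma word_nbhs_sigma (S : set path_space) :
  (forall x, S x -> exists n, word_set (mkseq (letter x) n) `<=` S) ->
  <<s range word_set >> S.
Proof.
move=> hS; pose U := g_sigma_algebraType (range word_set).
pose G w : set U := if `[< word_set w `<=` S >] then word_set w else set0.
have -> : S = \bigcup_w G w.
  apply/seteqP; split=> [x Sx|x [w _]]; last first.
    by rewrite /G; case: asboolP => // wS; exact: wS.
  have [n nS] := hS x Sx.
  exists (mkseq (letter x) n) => //; rewrite /G; case: asboolP => // _.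
  exact: word_set_mkseq.
apply: (@countable_bigcupT_measurable _ U _ G (countableP _)) => w.
rewrite /G; case: asboolP => // wS; apply: sub_sigma_algebra; exists w => //.
Qed.

Lemma measurable_word_sets :
  @measurable _ borel_path_space = <<s range word_set >>.
Proof.
apply/seteqP; split.
  apply: smallest_sub; first exact: smallest_sigma_algebra.
  by move=> O oO; apply: word_nbhs_sigma => x; exact: open_word_nbhs.
apply: smallest_sub; first exact: smallest_sigma_algebra.
by move=> _ [w _ <-]; exact: measurable_word_set.
Qed.

Lemma measurable_letters n (S : set borel_path_space) :
  (forall x y, (forall k, (k < n)%N -> letter x k = letter y k) -> S x -> S y) ->
  measurable S.
Proof.
move=> hS; rewrite measurable_word_sets; apply: word_nbhs_sigma => x Sx.
exists n => y /word_setP yx; apply: hS Sx => k kn.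
by rewrite yx ?size_mkseq // nth_mkseq.
Qed.

(** One of two words is a prefix of the other, or no path starts with both. *)
Lemma word_setI u v : word_set u `&` word_set v = set0 \/
  exists w, word_set u `&` word_set v = word_set w.
Proof.
wlog uv : u v / (size u <= size v)%N.
  move=> H; case: (leqP (size u) (size v)) => [|/ltnW] /H //.
  by rewrite setIC.
have [[x [xu xv]]|/set0P/negP/negPn/eqP] :=
  pselect (word_set u `&` word_set v !=set0); last by left.
right; exists v; apply/setIidPr.
by rewrite -[in word_set u]xu -[in word_set v]xv; exact: word_set_prefix.
Qed.

Lemma measure_eq_words (R : realType)
    (m1 m2 : {finite_measure set borel_path_space -> \bar R}) :
  (forall w, m1 (word_set w) = m2 (word_set w)) ->
  forall A, measurable A -> m1 A = m2 A.
Proof.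
move=> m12 A.
apply: (@measure_unique _ R borel_path_space (set0 |` range word_set)
  (fun=> setT)) => //.
- rewrite measurable_word_sets; apply/seteqP; split.
    by apply: sub_smallest2r => // C; right.
  apply: smallest_sub; first exact: smallest_sigma_algebra.
  move=> C [->|Cw]; last exact: sub_sigma_algebra.
  exact: (@measurable0 _ (g_sigma_algebraType (range word_set))).
- move=> C D [->|[u _ <-]]; first by rewrite set0I; left.
  move=> [->|[v _ <-]]; first by rewrite setI0; left.
  by have [->|[w ->]] := word_setI u v; [left|right; exists w].
- by move=> _; right; exists [::] => //; exact: word_set_nil.
- by rewrite bigcup_const //; exists 0%N.
- by move=> _ [->|[w _ <-]]; [rewrite !measure0|exact: m12].
- by move=> _; rewrite /= ltey_eq fin_num_measure.
Qed.

Lemma measurable_fun_words d (T : measurableType d)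
    (f : T -> borel_path_space) :
  (forall w, measurable (f @^-1` word_set w)) -> measurable_fun setT f.
Proof.
move=> fw; apply: measurability measurable_word_sets _.
by move=> _ [_ [w _ <-] <-]; rewrite setTI.
Qed.

(** * Removing and adding a prefix *)

Definition shift (k : nat) (x : borel_path_space) : borel_path_space :=
  of_letters (fun n => letter x (k + n)).

Definition prepend (u : seq nat) (x : borel_path_space) : borel_path_space :=
  of_letters (fun n => nth (letter x (n - size u)) u n).

Lemma letter_inj x y : (forall n, letter x n = letter y n) -> x = y.
Proof. by move=> /funext xy; rewrite -(letterK x) xy letterK. Qed.

Lemma word_set_cat u v x :
  word_set (u ++ v) x <-> word_set u x /\ word_set v (shift (size u) x).
Proof.
rewrite 3!word_setP size_cat; split=> [h|[hu hv] k kuv].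
  split=> k ks; first by rewrite h ?nth_cat ?ks // ltn_addr.
  by rewrite of_lettersK h ?ltn_add2l // nth_cat ltnNge leq_addr addKn.
rewrite nth_cat; case: ltnP => ku; first exact: hu.
by rewrite -hv ?ltn_subLR // of_lettersK subnKC.
Qed.

Lemma prependK u x : shift (size u) (prepend u x) = x.
Proof.
apply: letter_inj => n; rewrite !of_lettersK nth_default ?leq_addr //.
by rewrite addKn.
Qed.

Lemma word_set_prepend u x : word_set u (prepend u x).
Proof.
by apply/word_setP => k ku; rewrite of_lettersK; exact: set_nth_default.
Qed.

Lemma shiftK u x : word_set u x -> prepend u (shift (size u) x) = x.
Proof.
move=> /word_setP xu; apply: letter_inj => n; rewrite of_lettersK.
case: (ltnP n (size u)) => nu; first by rewrite (set_nth_default 0%N) ?xu.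
by rewrite nth_default // of_lettersK subnKC.
Qed.

Lemma bigcup_word_rcons w : word_set w = \bigcup_i word_set (rcons w i).
Proof.
apply/seteqP; split=> [x xw|x [i _]].
  exists (letter x (size w)) => //.
  by rewrite /word_set /= size_rcons mkseqS xw.
by rewrite -cats1 => /word_set_cat [].
Qed.

Lemma trivIset_word_rcons w : trivIset setT (fun i => word_set (rcons w i)).
Proof.
move=> i j _ _ [x []]; rewrite /word_set /= !size_rcons => -> /eqP.
by rewrite eqseq_rcons => /andP [_ /eqP].
Qed.

Lemma measurable_shift k : measurable_fun setT (shift k).
Proof.
apply: measurable_fun_words => w.
apply: (@measurable_letters (k + size w)) => x y xy /word_setP xw.
apply/word_setP => n nw.
by rewrite -xw // !of_lettersK xy // ltn_add2l.
Qed.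

Lemma measurable_prepend u : measurable_fun setT (prepend u).
Proof.
apply: measurable_fun_words => w.
apply: (@measurable_letters (size w)) => x y xy /word_setP xw.
apply/word_setP => n nw.
by rewrite -xw // !of_lettersK xy // (leq_ltn_trans (leq_subr _ _)).
Qed.

(** * Exchangeable measures *)

Section restricted_image.
Context d d' (T : measurableType d) (T' : measurableType d') (R : realType).
Variables (m : {measure set T -> \bar R}) (D : set T) (f : T -> T').
Hypotheses (mD : measurable D) (mf : measurable_fun setT f).
Hypothesis Doo : (m D < +oo)%E.

(** The proofs are arguments so that the measure structure can be inferred. *)
Definition restricted_image of measurable D & measurable_fun setT f &
    (m D < +oo)%E : set T' -> \bar R :=
  fun B => m (D `&` f @^-1` B).

Local Notation mi := (restricted_image mD mf Doo).

Let mpre B : measurable B -> measurable (f @^-1` B).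
Proof. by move=> mB; rewrite -[X in measurable X]setTI; exact: mf. Qed.

Let image0 : mi set0 = 0%E.
Proof. by rewrite /restricted_image preimage_set0 setI0 measure0. Qed.

Let image_ge0 B : (0 <= mi B)%E.
Proof. exact: measure_ge0. Qed.

Let image_sigma_additive : semi_sigma_additive mi.
Proof.
move=> F mF tF mUF; rewrite /restricted_image preimage_bigcup setI_bigcupr.
apply: measure_semi_sigma_additive.
- by move=> n; apply: measurableI => //; exact: mpre.
- apply/trivIsetP => /= i j _ _ ij; rewrite setIACA -preimage_setI.
  by move/trivIsetP : tF => /(_ _ _ _ _ ij) -> //; rewrite preimage_set0 setI0.
- rewrite -setI_bigcupr -preimage_bigcup; apply: measurableI => //.
  exact: mpre.
Qed.

HB.instance Definition _ := isMeasure.Build _ _ _ mi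
  image0 image_ge0 image_sigma_additive.

Let image_finite : fin_num_fun mi.
Proof.
apply: lty_fin_num_fun; rewrite /= /restricted_image preimage_setT setIT.
exact: Doo.
Qed.

HB.instance Definition _ := Measure_isFinite.Build _ _ _ mi image_finite.

End restricted_image.

Section exchangeable.
Context {R : realType}.
Implicit Types m : {finite_measure set borel_path_space -> \bar R}.

Definition exchangeable m : Prop :=
  forall u v, perm_eq u v -> m (word_set u) = m (word_set v).

Lemma finite_measure_lty m A : measurable A -> (m A < +oo)%E.
Proof. by move=> mA; rewrite ltey_eq fin_num_measure. Qed.

(** The law of the letters that follow the prefix [u], not normalised: its total
    mass is that of the paths that start with [u]. *)
Definition after m u : {finite_measure set borel_path_space -> \bar R} :=
  restricted_image (measurable_word_set u) (measurable_shift (size u))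
    (finite_measure_lty m (measurable_word_set u)).

Lemma afterE m u A : after m u A = m (word_set u `&` shift (size u) @^-1` A).
Proof. by []. Qed.

Lemma after_word m u w : after m u (word_set w) = m (word_set (u ++ w)).
Proof.
rewrite afterE; congr (m _); apply/seteqP; split=> x /word_set_cat //.
Qed.

Lemma after_total m u : after m u setT = m (word_set u).
Proof. by rewrite afterE preimage_setT setIT. Qed.

Lemma exchangeable_after m u : exchangeable m -> exchangeable (after m u).
Proof.
by move=> mex v w vw; rewrite !after_word; apply: mex; rewrite perm_cat2l.
Qed.

(** Although it only speaks of words, exchangeability makes it possible to permute a
    prefix in front of an arbitrary Borel set of continuations. *)
Lemma after_perm m u v A : exchangeable m -> perm_eq u v -> measurable A ->
  after m u A = after m v A.
Proof.
move=> mex uv; apply: measure_eq_words => w.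
by rewrite !after_word; apply: mex; rewrite perm_cat2r.
Qed.

Lemma measure_word_rcons m w :
  m (word_set w) = (\sum_(0 <= i <oo) m (word_set (rcons w i)))%E.
Proof.
rewrite {1}bigcup_word_rcons measure_semi_bigcup //.
- by move=> i; exact: measurable_word_set.
- exact: trivIset_word_rcons.
- by apply: bigcup_measurable => i _; exact: measurable_word_set.
Qed.

Lemma shift1_word w : shift 1 @^-1` word_set w = \bigcup_i word_set (i :: w).
Proof.
apply/seteqP; split=> [x xw|x [i _ /(word_set_cat [:: i] w) []] //].
by exists (letter x 0) => //; apply/(word_set_cat [:: letter x 0] w).
Qed.

(** Both sides are sums over one additional letter, which stands before the word
    on the left and after it on the right: these two words are permutations of
    each other. *)
Lemma exchangeable_shift m A : exchangeable m -> measurable A ->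
  m (shift 1 @^-1` A) = m A.
Proof.
move=> mex mA; pose ms := restricted_image measurableT (measurable_shift 1)
  (finite_measure_lty m measurableT).
have <- : ms A = m (shift 1 @^-1` A) by rewrite /ms /restricted_image setTI.
apply: (measure_eq_words _ mA) => w.
transitivity (m (shift 1 @^-1` word_set w)).
  by congr (m _); exact: setTI.
rewrite shift1_word measure_word_rcons.
rewrite measure_semi_bigcup //.
- by apply: eq_eseriesr => i _; apply: mex; rewrite -cats1 perm_sym perm_catC.
- by move=> i; exact: measurable_word_set.
- move=> i j _ _ [x []].
  rewrite -[i :: w]cat1s -[j :: w]cat1s.
  move=> /word_set_cat [xi _] /word_set_cat [xj _].
  by move: xi => [<-]; case: xj.
- by apply: bigcup_measurable => i _; exact: measurable_word_set.
Qed.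

End exchangeable.

(** * Saturation under tail equivalence *)

Lemma mkseq_catD (a : nat -> nat) k n :
  mkseq a (k + n) = mkseq a k ++ mkseq (fun i => a (k + i)%N) n.
Proof.
rewrite /mkseq iotaD map_cat; congr (_ ++ _).
by rewrite add0n -[k in iota k n]addn0 iotaDl -map_comp.
Qed.

Lemma mkseq_word_set u x n : word_set u x ->
  mkseq (letter x) (size u + n) = u ++ mkseq (letter (shift (size u) x)) n.
Proof.
move=> xu; rewrite mkseq_catD (xu : mkseq _ _ = u); congr (_ ++ _).
by apply: eq_mkseq => i; rewrite of_lettersK.
Qed.

(** Two paths meet at a level exactly if the words read so far are permutations of
    each other. *)
Lemma tail_equivalentP x y : tail_equivalent x y <->
  exists u v, [/\ perm_eq u v, word_set u x, word_set v y &
    shift (size u) x = shift (size v) y].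
Proof.
split=> [[N xy]|[u [v [uv xu yv suv]]]].
  exists (mkseq (letter x) N.+1), (mkseq (letter y) N.+1); split.
  - by apply/count_vertex_perm; rewrite -!path_letter xy.
  - exact: word_set_mkseq.
  - exact: word_set_mkseq.
  rewrite !size_mkseq; apply: letter_inj => n; rewrite !of_lettersK addSn.
  apply: (@count_vertex_rcons_inj (mkseq (letter x) (N + n).+1)
    (mkseq (letter y) (N + n).+1)).
    by rewrite -!path_letter xy // leq_addr.
  by rewrite -!mkseqS -!path_letter xy // leqW // leq_addr.
exists (size u) => n un.
rewrite !path_letter; apply/count_vertex_perm.
have nE : n.+1 = (size u + (n.+1 - size u))%N by rewrite subnKC // leqW.
rewrite [in X in perm_eq X _]nE mkseq_word_set //.
rewrite [in X in perm_eq _ X]nE [in X in perm_eq _ X](perm_size uv).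
by rewrite mkseq_word_set // -suv (perm_size uv) perm_cat2r.
Qed.

Lemma tail_equivalent_sym x y : tail_equivalent x y -> tail_equivalent y x.
Proof. by move=> [N xy]; exists N => n Nn; rewrite xy. Qed.

Lemma tail_equivalent_trans x y z :
  tail_equivalent x y -> tail_equivalent y z -> tail_equivalent x z.
Proof.
move=> [N xy] [M yz]; exists (maxn N M) => n.
by rewrite geq_max => /andP [Nn Mn]; rewrite xy ?yz.
Qed.

(** The image of the paths of [A] that start with [u] when this prefix is replaced
    by [v]. For [u] and [v] permutations of each other, these partial bijections
    generate tail equivalence. *)
Definition swap_prefix (u v : seq nat) (A : set borel_path_space) :
    set borel_path_space :=
  word_set v `&` shift (size v) @^-1` (prepend u @^-1` A).

Lemma measurable_prepend_preimage u (A : set borel_path_space) :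
  measurable A -> measurable (prepend u @^-1` A).
Proof.
by move=> mA; rewrite -[X in measurable X]setTI; exact: measurable_prepend.
Qed.

Lemma measurable_shift_preimage k (A : set borel_path_space) :
  measurable A -> measurable (shift k @^-1` A).
Proof.
by move=> mA; rewrite -[X in measurable X]setTI; exact: measurable_shift.
Qed.

Lemma measurable_swap_prefix u v (A : set borel_path_space) :
  measurable A -> measurable (swap_prefix u v A).
Proof.
move=> mA; apply: measurableI; first exact: measurable_word_set.
by apply: measurable_shift_preimage; exact: measurable_prepend_preimage.
Qed.

Lemma swap_prefix_id u (A : set borel_path_space) :
  swap_prefix u u A = word_set u `&` A.
Proof.
by apply/seteqP; split=> x [xu /= Ax]; split=> //=; move: Ax; rewrite shiftK.
Qed.

Section saturation.
Context {R : realType}.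

Lemma exchangeable_swap_prefix
    (m : {finite_measure set borel_path_space -> \bar R}) u v A :
  exchangeable m -> perm_eq u v -> measurable A ->
  m (swap_prefix u v A) = m (word_set u `&` A).
Proof.
move=> mex uv mA; rewrite -swap_prefix_id -!afterE.
by apply/esym/after_perm => //; exact: measurable_prepend_preimage.
Qed.

(** The union is indexed by natural numbers, which code the pairs of words, in
    order to apply results on countable unions of sets. *)
Definition saturate (A : set borel_path_space) : set borel_path_space :=
  \bigcup_n
    if (choice.unpickle n : option (seq nat * seq nat)%type) is Some (u, v) then
    if perm_eq u v then swap_prefix u v A else set0 else set0.

Lemma saturateE A :
  saturate A = [set y | exists x, A x /\ tail_equivalent x y].
Proof.
apply/seteqP; split=> [y [n _]|y [x [Ax]]]; last first.
  move=> /tail_equivalentP [u [v [uv xu yv suv]]].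
  exists (choice.pickle (u, v)) => //; rewrite choice.pickleK uv; split=> //=.
  by rewrite -suv shiftK.
case: choice.unpickle => [[u v]|//]; case: ifP => // uv [yv Ay].
exists (prepend u (shift (size v) y)); split=> //.
apply/tail_equivalentP; exists u, v; split=> //; last exact: prependK.
exact: word_set_prepend.
Qed.

Lemma tail_saturated_saturate A : tail_saturated (saturate A).
Proof.
move=> x y xy; rewrite saturateE => -[z [Az zx]]; exists z; split=> //.
exact: tail_equivalent_trans xy.
Qed.

Lemma sub_saturate A : A `<=` saturate A.
Proof. by move=> x Ax; rewrite saturateE; exists x; split=> //; exists 0%N. Qed.

Local Open Scope charge_scope.

Lemma negative_set_saturate
    (k : {charge set borel_path_space -> \bar R}) (N : set borel_path_space) :
  (forall u v A, perm_eq u v -> measurable A ->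
     k (swap_prefix u v A) = k (word_set u `&` A)) ->
  k.-negative_set N -> k.-negative_set (saturate N).
Proof.
move=> kinv [mN kN]; apply: bigcup_negative_set => n.
case: choice.unpickle => [[u v]|]; last exact: negative_set0.
case: ifP => uv; last exact: negative_set0.
split; first exact: measurable_swap_prefix.
move=> A mA AN.
(* Swapping the prefixes back sends the subset [A] of the swapped set into
   [N], without changing its charge. *)
have -> : A = word_set v `&` A.
  by apply/esym/setIidPr => x /AN [].
rewrite -(kinv v u) ?(perm_sym v u) //; apply: kN.
  exact: measurable_swap_prefix.
move=> x [xu /AN [_ /=]].
by rewrite prependK shiftK.
Qed.

End saturation.

(** * Ergodic exchangeable measures are product measures *)

Section ergodic_product.
Context {R : realType}.
Implicit Types nu : probability borel_path_space R.
Implicit Types m : {finite_measure set borel_path_space -> \bar R}.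

Local Open Scope charge_scope.
Local Open Scope ereal_scope.

(** An exchangeable [m] absolutely continuous with respect to an ergodic [nu] is
    proportional to [nu]: morally, its density is invariant, hence constant. The
    proof uses a Hahn decomposition instead of the density, since the saturation
    of a negative set is a set that is exactly invariant. *)
Lemma ergodic_proportional nu m : exchangeable nu -> ergodic nu ->
  exchangeable m ->
  (forall A, measurable A -> nu A = 0 -> m A = 0) ->
  forall A, measurable A -> m A = m setT * nu A.
Proof.
move=> nuex nuerg mex mnu.
have [c mT] : exists c, m setT = c%:E.
  by exists (fine (m setT)); rewrite fineK // fin_num_measure.
pose k := cadd (charge_of_finite_measure m)
  (cscale (- c) (charge_of_finite_measure nu)).
have kE A : k A = m A + (- c)%:E * nu A by [].
have kT : k setT = 0.
  by rewrite kE mT probability_setT mule1 -EFinD subrr.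
have kinv u v A : perm_eq u v -> measurable A ->
    k (swap_prefix u v A) = k (word_set u `&` A).
  move=> uv mA; rewrite !kE; congr (_ + _ * _); exact: exchangeable_swap_prefix.
have knull A : measurable A -> nu A = 0 -> k A = 0.
  by move=> mA nuA; rewrite kE nuA mnu // mule0 adde0.
have kD S A : measurable S -> measurable A ->
    k A = k (A `&` S) + k (A `&` ~` S).
  move=> mS mA; rewrite -chargeU; last 3 first.
  - exact: measurableI.
  - by apply: measurableI => //; exact: measurableC.
  - by rewrite setIACA setICr setI0.
  by rewrite -setIUr setUv setIT.
have nu_sub A B : measurable A -> measurable B -> nu B = 0 -> nu (A `&` B) = 0.
  move=> mA mB B0; apply/eqP; rewrite eq_le measure_ge0 andbT -B0.
  by apply: le_measure; rewrite ?inE //; exact: measurableI.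
have [P [N [Ppos Nneg PN _]]] := Hahn_decomposition k.
have [mS Sneg] := negative_set_saturate kinv Nneg.
set S := saturate N in mS Sneg.
have mCS : measurable (~` S) by exact: measurableC.
(* If the saturated negative set [S] is null, the charge lives on its
   complement, which is part of the positive set; otherwise it lives on [S]. *)
have sgn : (forall A, measurable A -> k A <= 0) \/
    (forall A, measurable A -> 0 <= k A).
  have [S0|S1] := nuerg S mS (@tail_saturated_saturate N); [right|left] => A mA;
    rewrite (kD S A mS mA).
    rewrite (knull (A `&` S)); [|exact: measurableI|exact: nu_sub].
    rewrite add0e; apply: Ppos.2; first exact: measurableI.
    move=> x [_ xS]; have : (P `|` N) x by rewrite PN.
    by case=> // Nx; case: xS; exact: sub_saturate.
  rewrite (knull (A `&` ~` S)); [|exact: measurableI|].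
    rewrite adde0; apply: Sneg; last exact: subIsetr.
    exact: measurableI.
  apply: nu_sub => //; rewrite probability_setC // S1 subee //.
have k0 A : measurable A -> k A = 0.
  move=> mA; have mCA := measurableC mA.
  have := kD A setT mA measurableT; rewrite !setTI kT => /esym kA.
  case: sgn => sgn; apply/eqP; rewrite eq_le sgn //=.
    rewrite -kA -[leRHS]adde0; apply: leeD => //; exact: sgn.
  rewrite andbT -kA -[leLHS]adde0; apply: leeD => //; exact: sgn.
move=> A mA; have := k0 A mA; rewrite kE mT => /eqP.
rewrite EFinN mulNe sube_eq ?add0e; [by move/eqP| |].
  by rewrite fin_num_measure.
by rewrite fin_num_adde_defl // fin_numM // fin_num_measure.
Qed.

Lemma ergodic_product nu : exchangeable nu -> ergodic nu ->
  forall w, nu (word_set w) = (\prod_(i <- w) fine (nu (word_set [:: i])))%:E.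
Proof.
move=> nuex nuerg; elim=> [|i w IH].
  by rewrite word_set_nil probability_setT big_nil.
have ac A : measurable A -> nu A = 0 -> after nu [:: i] A = 0.
  move=> mA A0; apply/eqP; rewrite eq_le measure_ge0 andbT afterE.
  have <- : nu (shift 1 @^-1` A) = 0 by rewrite (exchangeable_shift nuex mA).
  apply: le_measure; rewrite ?inE /=.
  - apply: measurableI; first exact: measurable_word_set.
    exact: measurable_shift_preimage.
  - exact: measurable_shift_preimage.
  - exact: subIsetr.
rewrite big_cons EFinM -IH fineK; last first.
  by rewrite fin_num_measure //; exact: measurable_word_set.
have := ergodic_proportional nuex nuerg (exchangeable_after [:: i] nuex) ac
  (measurable_word_set w).
by rewrite after_word after_total.
Qed.

End ergodic_product.

(** * The second moment of an exchangeable measure *)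

Section mean.
Context d (T : measurableType d) (R : realType).
Variable m : {finite_measure set T -> \bar R}.

(** Integrability and the value of the integral are kept together so that both
    follow the structure of a finite combination of indicators. *)
Definition has_mean (f : T -> R) (v : R) : Prop :=
  m.-integrable setT (EFin \o f) /\ (\int[m]_x (f x)%:E = v%:E)%E.

Lemma has_mean_indic A : measurable A -> has_mean \1_A (fine (m A)).
Proof.
move=> mA; split; first exact: integrable_indic.
by rewrite integral_indic // setIT fineK // fin_num_measure.
Qed.

Lemma has_meanD f g a b : has_mean f a -> has_mean g b ->
  has_mean (fun x => f x + g x) (a + b).
Proof.
move=> [fi fa] [gi gb]; split; first exact: (integrableD measurableT fi gi).
by rewrite integralD_EFin // fa gb.
Qed.

Lemma has_meanZ f a c : has_mean f a -> has_mean (fun x => c * f x) (c * a).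
Proof.
move=> [fi fa]; split; first exact: (integrableZl measurableT _ fi).
under eq_integral do rewrite EFinM.
by rewrite (integralZl measurableT fi) fa.
Qed.

Lemma has_mean_sum (I : Type) (s : seq I) (f : I -> T -> R) (a : I -> R) :
  (forall i, has_mean (f i) (a i)) ->
  has_mean (fun x => \sum_(i <- s) f i x) (\sum_(i <- s) a i).
Proof.
move=> fa; elim: s => [|i s IH].
  rewrite big_nil; under eq_fun do rewrite big_nil.
  split; first exact: integrable0.
  by rewrite integral0.
rewrite big_cons; under eq_fun do rewrite big_cons.
exact: has_meanD.
Qed.

Lemma has_mean_ge0 f a : (forall x, 0 <= f x) -> has_mean f a -> 0 <= a.
Proof.
move=> f0 [_ fa]; rewrite -lee_fin -fa.
by apply: integral_ge0 => x _; rewrite lee_fin.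
Qed.

(** The right-hand side is the integral of the square of the sum over [k < n] of
    the functions equal to [1 - t] on [B k] and to [- t] elsewhere. *)
Lemma pair_moments_ge0 (B : nat -> set T) (t : R) n :
  (forall k, measurable (B k)) ->
  0 <= \sum_(k < n) \sum_(l < n) (fine (m (B k `&` B l)) -
    t * fine (m (B k)) - t * fine (m (B l)) + t ^+ 2 * fine (m setT)).
Proof.
move=> mB.
apply: (@has_mean_ge0 (fun x => \sum_(k < n) \sum_(l < n) (\1_(B k `&` B l) x +
  (- t) * \1_(B k) x + (- t) * \1_(B l) x + t ^+ 2 * \1_setT x))).
  move=> x; suff -> : \sum_(k < n) \sum_(l < n) (\1_(B k `&` B l) x +
      (- t) * \1_(B k) x + (- t) * \1_(B l) x + t ^+ 2 * \1_setT x) =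
      (\sum_(k < n) (\1_(B k) x - t)) ^+ 2 :> R by exact: sqr_ge0.
  rewrite [RHS]expr2 mulr_suml; apply: eq_bigr => k _.
  rewrite mulr_sumr; apply: eq_bigr => l _.
  by rewrite indicI indicT /=; ring.
apply: has_mean_sum => k; apply: has_mean_sum => l; rewrite -2!mulNr.
apply: has_meanD; last by apply: has_meanZ; exact: has_mean_indic.
apply: has_meanD; last by apply: has_meanZ; exact: has_mean_indic.
apply: has_meanD; last by apply: has_meanZ; exact: has_mean_indic.
by apply: has_mean_indic; exact: measurableI.
Qed.

End mean.

Section second_moment.
Context {R : realType}.
Implicit Types m : {finite_measure set borel_path_space -> \bar R}.

Definition letter_set (k i : nat) : set borel_path_space :=
  [set x | letter x k = i].

Lemma measurable_letter_set k i : measurable (letter_set k i).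
Proof.
apply: (@measurable_letters k.+1) => x y xy.
by rewrite /letter_set /= xy.
Qed.

Lemma letter_set0 i : letter_set 0 i = word_set [:: i].
Proof.
apply/seteqP; split=> x; first by move=> xi; apply/word_setP => -[].
by move=> /word_setP /(_ 0%N isT).
Qed.

Lemma letter_setS k i : letter_set k.+1 i = shift 1 @^-1` letter_set k i.
Proof.
by apply/seteqP; split=> x; rewrite /letter_set /= of_lettersK.
Qed.

Lemma exchangeable_letter m k i : exchangeable m ->
  m (letter_set k i) = m (word_set [:: i]).
Proof.
move=> mex; elim: k => [|k IH]; first by rewrite letter_set0.
by rewrite letter_setS exchangeable_shift //; exact: measurable_letter_set.
Qed.

(** Shifting reduces to [k = 0]; what follows a first letter [i] is again
    exchangeable, so the second [i] can be moved next to the first. *)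
Lemma exchangeable_letter2 m k l i : exchangeable m -> k != l ->
  m (letter_set k i `&` letter_set l i) = m (word_set [:: i; i]).
Proof.
move=> mex; wlog kl : k l / (k < l)%N.
  move=> H; case: (ltngtP k l) => // [kl|lk] _.
    by apply: H; rewrite ?ltn_eqF.
  by rewrite setIC; apply: H; rewrite ?ltn_eqF.
move=> _; elim: k l kl => [|k IH] [//|l] kl.
  rewrite letter_set0 letter_setS -[_ `&` _]/(_ `&` _) -(@afterE _ m [:: i]).
  rewrite exchangeable_letter; last exact: exchangeable_after.
  by rewrite after_word.
rewrite !letter_setS -preimage_setI exchangeable_shift ?IH //.
by apply: measurableI; exact: measurable_letter_set.
Qed.

(** Among the [(n + 1)^2] terms of [pair_moments_ge0] for the events that letter
    number [k] is [i], the [n (n + 1)] terms off the diagonal all equal the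
    present quantity, and they dominate the diagonal as [n] grows. *)
Lemma exchangeable_second_moment m i t : exchangeable m ->
  0 <= fine (m (word_set [:: i; i])) - 2 * t * fine (m (word_set [:: i])) +
    t ^+ 2 * fine (m setT).
Proof.
move=> mex; set q := (X in 0 <= X).
pose q1 := fine (m (word_set [:: i])) - 2 * t * fine (m (word_set [:: i])) +
  t ^+ 2 * fine (m setT).
have H n : 0 <= q1 + n%:R * q.
  have := pair_moments_ge0 m t n.+1 (fun k => measurable_letter_set k i).
  rewrite (eq_bigr (fun=> q1 + n%:R * q)) => [|k _].
    by rewrite sumr_const card_ord pmulrn_lge0.
  rewrite (bigD1 k) //= setIid !exchangeable_letter //; congr (_ + _).
    by rewrite /q1; ring.
  rewrite (eq_bigr (fun=> q)) => [|l lk].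
    by rewrite sumr_const cardC1 card_ord mulr_natl.
  rewrite exchangeable_letter2 ?exchangeable_letter //; last by rewrite eq_sym.
  by rewrite /q; ring.
rewrite leNgt; apply/negP => q0.
have := H (Num.bound `|q1 / - q|).
have : q1 / - q < (Num.bound `|q1 / - q|)%:R.
  by apply: le_lt_trans (ler_norm _) _; exact: archi_boundP.
rewrite ltr_pdivrMr ?oppr_gt0 // mulrN => h1 h2.
by move: h1; rewrite ltNge => /negP; apply; lra.
Qed.

(** Let [q t] be the second moment of [exchangeable_second_moment]. It is
    additive in the measure, and it vanishes at [t = d] for the sum of the two
    measures; since both of its summands are nonnegative, each vanishes. But
    [q t] is a nonnegative quadratic polynomial in [t], so its derivative
    vanishes at [d] too. *)
Lemma exchangeable_summand_letter m m' (d c : R) i :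
  exchangeable m -> exchangeable m' ->
  fine (m setT) + fine (m' setT) = c ->
  fine (m (word_set [:: i])) + fine (m' (word_set [:: i])) = c * d ->
  fine (m (word_set [:: i; i])) + fine (m' (word_set [:: i; i])) = c * d ^+ 2 ->
  fine (m (word_set [:: i])) = d * fine (m setT).
Proof.
move=> mex mex' s0 s1 s2.
have q := exchangeable_second_moment i _ mex.
have q' := exchangeable_second_moment i d mex'.
have qd := q d.
move: q q' qd s0 s1 s2; move: (fine (m' setT)) (fine (m' (word_set [:: i])))
  (fine (m' (word_set [:: i; i]))) => a0 a1 a2.
have : 0 <= fine (m setT) by exact: fine_ge0.
move: (fine (m setT)) (fine (m (word_set [:: i])))
  (fine (m (word_set [:: i; i]))) => b0 b1 b2 b00 q q' qd s0 s1 s2.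
have q0 : b2 - 2 * d * b1 + d ^+ 2 * b0 = 0.
  apply/eqP; rewrite eq_le qd andbT.
  have <- : b2 + a2 - 2 * d * (b1 + a1) + d ^+ 2 * (b0 + a0) = 0.
    by rewrite s0 s1 s2; ring.
  lra.
(* The polynomial at [d + e] is [2 e g + e^2 b0]; the chosen [e] satisfies
   [g = - e (1 + b0)], which makes this negative unless [e = 0]. *)
pose g := d * b0 - b1; pose e := - g / (1 + b0).
have b1p : 0 < 1 + b0 by rewrite ltr_wpDr.
have eE : e * (1 + b0) = - g by rewrite divfK // gt_eqF.
have := q (d + e).
have -> : b2 - 2 * (d + e) * b1 + (d + e) ^+ 2 * b0 =
    b2 - 2 * d * b1 + d ^+ 2 * b0 + (2 * e * g + e ^+ 2 * b0).
  by rewrite /g; ring.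
have -> : g = - (e * (1 + b0)) by rewrite eE opprK.
rewrite q0 add0r => h.
have : e = 0.
  by apply/eqP; rewrite -sqrf_eq0 eq_le sqr_ge0 andbT; nra.
move=> e0; move: eE; rewrite e0 mul0r /g => /esym/eqP.
by rewrite oppr_eq0 subr_eq0 => /eqP.
Qed.

(** The hypothesis passes from [m] and [m'] to the laws after a first letter [i],
    with [c * d i] instead of [c]. *)
Lemma exchangeable_summand_product (d : nat -> R) w m m' (c : R) :
  exchangeable m -> exchangeable m' ->
  (forall u, fine (m (word_set u)) + fine (m' (word_set u)) =
     c * \prod_(i <- u) d i) ->
  fine (m (word_set w)) = (\prod_(i <- w) d i) * fine (m setT).
Proof.
elim: w m m' c => [|i w IH] m m' c mex mex' mm'.
  by rewrite big_nil mul1r word_set_nil.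
have := IH (after m [:: i]) (after m' [:: i]) (c * d i)
  (exchangeable_after _ mex) (exchangeable_after _ mex').
rewrite after_word after_total => ->; last first.
  by move=> u; rewrite !after_word mm' big_cons mulrA.
rewrite (@exchangeable_summand_letter m m' (d i) c) //.
- by rewrite big_cons; ring.
- by have := mm' [::]; rewrite big_nil mulr1 word_set_nil.
- by rewrite mm' big_seq1.
- by rewrite mm' big_cons big_seq1 expr2.
Qed.

End second_moment.

(** * Product measures are ergodic *)

Section product_ergodic.
Context {R : realType}.

Lemma product_exchangeable (nu : probability borel_path_space R) d :
  (forall w, nu (word_set w) = (\prod_(i <- w) d i)%:E) -> exchangeable nu.
Proof.
move=> nud u v uv; transitivity ((\prod_(i <- u) d i)%:E); first exact: nud.
by rewrite (perm_big _ uv); exact/esym/nud.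
Qed.

(** Replacing a prefix by a permutation of it preserves a saturated set. *)
Lemma exchangeable_restriction (nu : probability borel_path_space R)
    (A : set borel_path_space) (mA : measurable A) :
  exchangeable nu -> tail_saturated A ->
  exchangeable (restricted_image mA (@measurable_id _ _ setT)
    (finite_measure_lty nu mA)).
Proof.
move=> nuex Asat u v uv; rewrite /= /restricted_image /=.
rewrite setIC -(exchangeable_swap_prefix nuex uv mA) setIC.
have -> // : swap_prefix u v A = word_set v `&` A.
have swapE y : word_set v y ->
    tail_equivalent (prepend u (shift (size v) y)) y.
  move=> yv; apply/tail_equivalentP; exists u, v; split=> //.
    exact: word_set_prepend.
  by rewrite prependK.
apply/seteqP; split=> y [yv Ay]; split=> //.
  exact: Asat (swapE y yv) Ay.
by apply: Asat Ay; apply: tail_equivalent_sym; exact: swapE.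
Qed.

Lemma product_ergodic (nu : probability borel_path_space R) d :
  (forall w, nu (word_set w) = (\prod_(i <- w) d i)%:E) -> ergodic nu.
Proof.
move=> nud A mA Asat; have nuex := product_exchangeable nud.
have mCA := measurableC mA.
have CAsat : tail_saturated (~` A).
  move=> x y xy nAx Ay; apply: nAx; apply: Asat Ay.
  exact: tail_equivalent_sym.
pose mid := @measurable_id _ borel_path_space setT.
pose m := restricted_image mA mid (finite_measure_lty nu mA).
pose m' := restricted_image mCA mid (finite_measure_lty nu mCA).
have split_nu w : fine (m (word_set w)) + fine (m' (word_set w)) =
    1 * \prod_(i <- w) d i.
  have mw := measurable_word_set w.
  rewrite mul1r -[RHS]/(fine (_%:E)) -nud -fineD ?fin_num_measure //.
  rewrite /m /m' /restricted_image /= -measureU //.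
  - by rewrite -setIUl setUv setTI.
  - exact: measurableI.
  - exact: measurableI.
  - by rewrite setIACA setICr set0I.
have mE w : m (word_set w) = (nu A * nu (word_set w))%E.
  have mw : fine (m (word_set w)) = (\prod_(i <- w) d i) * fine (m setT).
    exact: exchangeable_summand_product (exchangeable_restriction mA nuex Asat)
      (exchangeable_restriction mCA nuex CAsat) split_nu.
  rewrite -[LHS]fineK ?fin_num_measure //; last exact: measurable_word_set.
  rewrite mw EFinM -nud muleC; congr (_ * _)%E.
  rewrite fineK ?fin_num_measure //.
  by rewrite /m /restricted_image /= preimage_setT setIT.
have r0 : 0 <= fine (nu A) by exact: fine_ge0.
have nuA : nu A = (nu A * nu A)%E.
  have := @measure_eq_words _ m (mscale (NngNum r0) nu) _ A mA.
  rewrite /m /restricted_image /= setIid /mscale /= fineK ?fin_num_measure //.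
  by apply=> w; rewrite -mE.
have : nu A \is a fin_num by exact: fin_num_measure.
move: nuA; case: (nu A) => // r [] /eqP; rewrite -{1}[r]mulr1 -subr_eq0 -mulrBr.
rewrite mulf_eq0 subr_eq0 => /orP [/eqP ->|/eqP <-] _; [by left|by right].
Qed.

End product_ergodic.

(** * Construction of the product measures *)

Section interval_coding.
Context {R : realType}.
Variable d : nat -> R.
Hypothesis d_prob : probability_vector d.

Let cumul n := \sum_(i < n) d i.

Let d_ge0 i : 0 <= d i. Proof. by case: d_prob. Qed.

Let cumulS n : cumul n.+1 = cumul n + d n.
Proof. exact: big_ord_recr. Qed.

Let cumul_le : {homo cumul : n k / (n <= k)%N >-> n <= k}.
Proof.
by apply: homo_leq => [//|? ? ?|n]; [exact: le_trans|rewrite cumulS lerDl].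
Qed.

Let cumul_le1 n : cumul n <= 1.
Proof.
case: d_prob => _ d1; rewrite -lee_fin -d1 -sumEFin.
rewrite -(big_mkord xpredT (EFin \o d)).
by apply: nneseries_lim_ge => i _ _; rewrite lee_fin.
Qed.

Let cumul_gt u : u < 1 -> exists n, u < cumul n.
Proof.
move=> u1; apply: contrapT => nu.
have : (1 <= u%:E)%E.
  case: d_prob => _ <-; apply: lime_le.
    by apply: is_cvg_nneseries => i _ _; rewrite lee_fin.
  apply: nearW => n; rewrite big_mkord sumEFin lee_fin leNgt.
  by apply/negP => un; apply: nu; exists n.
by rewrite lee_fin leNgt u1.
Qed.

Let cell (u : R) : set nat := [set i | cumul i <= u < cumul i.+1].

(** The index of the interval of the partition with lengths [d 0], [d 1], ... that
    contains [u]. *)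
Definition digit (u : R) : nat := xget 0%N (cell u).

(** The affine map of the interval containing [u] onto the unit interval. *)
Definition rescale (u : R) : R := (u - cumul (digit u)) / d (digit u).

Let cell_uniq u i j : cell u i -> cell u j -> i = j.
Proof.
wlog ij : i j / (i < j)%N.
  move=> H ui uj; case: (ltngtP i j) => // ij; first exact: H.
  by apply/esym; exact: H.
move=> /andP [_ ui] /andP [uj _].
by move: (lt_le_trans ui (le_trans (cumul_le ij) uj)); rewrite ltxx.
Qed.

Let digitE u i : cumul i <= u < cumul i.+1 -> digit u = i.
Proof.
by move=> ui; apply: (@cell_uniq u) => //; exact: xgetPex (ex_intro _ i ui).
Qed.

Let digitP u : 0 <= u < 1 -> cumul (digit u) <= u < cumul (digit u).+1.
Proof.
move=> /andP [u0 /cumul_gt /ex_minnP [[|n] un min_n]].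
  by move: un; rewrite /cumul big_ord0 ltNge u0.
suff un' : cell u n by exact: (xgetPex 0%N (ex_intro _ n un')).
apply/andP; split=> //; rewrite leNgt; apply/negP => /min_n.
by rewrite ltnn.
Qed.

Let word_start (w : seq nat) : R :=
  foldr (fun i a => cumul i + d i * a) 0 w.

Let weight_ge0 w : 0 <= \prod_(i <- w) d i.
Proof. exact: prodr_ge0. Qed.

Let word_start_ge0 w : 0 <= word_start w.
Proof.
elim: w => //= i w IH; rewrite addr_ge0 ?mulr_ge0 //; exact: sumr_ge0.
Qed.

Let word_end_le1 w : word_start w + \prod_(i <- w) d i <= 1.
Proof.
elim: w => [|i w IH] /=; first by rewrite big_nil add0r.
rewrite big_cons -addrA -mulrDr; apply: le_trans (cumul_le1 i.+1).
by rewrite cumulS lerD2l ler_piMr.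
Qed.

(** Letters of weight zero are covered too: they have an empty cell, so no [u]
    satisfies either side for a word that contains one. *)
Let codingP w u : 0 <= u < 1 ->
  mkseq (fun n => digit (iter n rescale u)) (size w) = w <->
  word_start w <= u < word_start w + \prod_(i <- w) d i.
Proof.
elim: w u => [|i w IH] u u01 /=; first by rewrite big_nil add0r u01; split.
have -> : mkseq (fun n => digit (iter n rescale u)) (size w).+1 =
    digit u :: mkseq (fun n => digit (iter n rescale (rescale u))) (size w).
  rewrite /mkseq /= -[1%N]addn0 iotaDl -map_comp; congr cons.
  by apply: eq_map => n; rewrite /comp add1n iterSr.
rewrite big_cons -addrA -mulrDr.
have ui : cumul i <= u < cumul i.+1 ->
    [/\ 0 < d i, d i * ((u - cumul i) / d i) = u - cumul i &
        0 <= (u - cumul i) / d i < 1].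
  move=> /andP [iu]; rewrite cumulS -ltrBlDl => ui.
  have di : 0 < d i by apply: le_lt_trans ui; rewrite subr_ge0.
  split=> //; first by rewrite mulrC divfK // gt_eqF.
  by rewrite ltr_pdivrMr // mul1r ui andbT divr_ge0 ?subr_ge0.
split=> [[ui' wE]|/andP [wu uw]].
  have := digitP u01; rewrite ui' => /ui [di dx x01].
  have rE : rescale u = (u - cumul i) / d i by rewrite /rescale ui'.
  move: wE; rewrite rE => /(IH _ x01) /andP [wx xw].
  move: wx xw; rewrite -(ler_pM2l di) -[(_ < _)](ltr_pM2l di) dx.
  by rewrite lerBrDl ltrBlDl => -> ->.
have iu : cumul i <= u < cumul i.+1.
  rewrite (le_trans _ wu) ?lerDl ?mulr_ge0 //= (lt_le_trans uw) //.
  by rewrite cumulS lerD2l ler_piMr.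
have [di dx x01] := ui iu.
have rE : rescale u = (u - cumul i) / d i by rewrite /rescale (digitE iu).
rewrite (digitE iu) rE; congr cons.
apply/(IH _ x01); rewrite -(ler_pM2l di) -(ltr_pM2l di) dx.
by rewrite lerBrDl wu ltrBlDl.
Qed.

(** Points outside the unit interval are sent to the code of [0], which makes the
    map total and measurable on the whole line. *)
Definition code (u : R) : borel_path_space :=
  of_letters (fun n => digit (iter n rescale (if 0 <= u < 1 then u else 0))).

Let code_word w u : 0 <= u < 1 ->
  word_set w (code u) <-> word_start w <= u < word_start w + \prod_(i <- w) d i.
Proof.
move=> u01; rewrite -codingP // /word_set /= /code u01.
by rewrite (eq_mkseq (of_lettersK _)).
Qed.

Let measurable_code : measurable_fun [set: measurableTypeR R] code.
Proof.
apply: measurable_fun_words => w.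
have -> : code @^-1` word_set w =
    (`[0, 1[%classic `&` `[word_start w, word_start w + \prod_(i <- w) d i[%classic)
    `|` (~` `[0, 1[%classic `&` (if `[< word_set w (code 0) >] then setT else set0)).
  apply/seteqP; split=> u /=; rewrite !in_itv /=.
    case: (boolP (0 <= u < 1)) => u01; first by move=> /(code_word _ u01); left.
    move=> uw; right; split=> //; case: asboolP => // -[].
    by move: uw; rewrite /code (negbTE u01) lexx ltr01.
  move=> [[u01 uw]|[/negP u01]]; first by apply/code_word.
  case: asboolP => // + _; by rewrite /code (negbTE u01) lexx ltr01.
apply: measurableU; apply: measurableI => //.
  by apply: measurableC; exact: measurable_itv.
by case: asboolP.
Qed.

Lemma product_measure_exists : exists mu : probability borel_path_space R,
  forall w, mu (word_set w) = (\prod_(i <- w) d i)%:E.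
Proof.
have mI : measurable (`[0, 1[%classic : set (measurableTypeR R)).
  exact: measurable_itv.
have I1 :
    lebesgue_measure (`[0%R, 1%R[%classic : set (measurableTypeR R)) = 1%E.
  by rewrite lebesgue_measure_itv /= lte_fin ltr01 -EFinD subr0.
have Ioo : (lebesgue_measure
    (`[0%R, 1%R[%classic : set (measurableTypeR R)) < +oo)%E by rewrite I1 ltry.
pose mu := restricted_image mI measurable_code Ioo.
have muT : mu setT = 1%E by rewrite /mu /restricted_image preimage_setT setIT.
pose P := Measure_isProbability.Build _ _ _ mu muT.
pose muP : probability borel_path_space R := HB.pack mu P.
exists muP => w.
transitivity (lebesgue_measure (`[0, 1[ `&` code @^-1` word_set w)) => //.
have -> : `[0, 1[ `&` code @^-1` word_set w =
    `[word_start w, word_start w + \prod_(i <- w) d i[%classic.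
  apply/seteqP; split=> u /=; rewrite !in_itv /=.
    by move=> [u01 /(code_word _ u01)].
  move=> /[dup] uw /andP [wu uw'].
  have u01 : 0 <= u < 1.
    rewrite (le_trans _ wu) ?word_start_ge0 //=.
    exact: lt_le_trans uw' (word_end_le1 w).
  by split=> //; apply/code_word.
rewrite lebesgue_measure_itv /= lte_fin ltrDl.
case: ltP => [_|w0]; first by rewrite -EFinD addrAC subrr add0r.
by congr (_%:E); apply/eqP; rewrite eq_le w0 weight_ge0.
Qed.

End interval_coding.

(** * The measures of the theorem in terms of words *)

Lemma vertex_weight_word (R : realType) (d : nat -> R) w :
  vertex_weight d (count_vertex w) = \prod_(i <- w) d i.
Proof.
rewrite /vertex_weight -[RHS]big_undup_iterop_count /=.
rewrite (perm_big (undup w)) /=; last first.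
  apply: uniq_perm; [exact: fset_uniq|exact: undup_uniq|move=> i].
  by rewrite mem_finsupp count_vertexE mem_undup -lt0n -has_count has_pred1.
by apply: eq_bigr => i _; rewrite count_vertexE.
Qed.

Lemma tail_invariantP (R : realType) (mu : probability borel_path_space R) :
  tail_invariant mu <-> exchangeable mu.
Proof.
split=> [muti u v uv|muex v p w q vp wq lvw].
  have [/size0nil u0|u0] := posnP (size u).
    by move: uv; rewrite u0 perm_sym => /perm_nilP ->.
  have v0 : (0 < size v)%N by rewrite -(perm_size uv).
  have [s [p [sp <- lu]]] := word_finite_path u0.
  have [t [q [tq <- lv]]] := word_finite_path v0.
  by apply: muti => //; rewrite lu lv; exact/count_vertex_perm.
have [u [_ -> lu]] := finite_path_word vp.
have [u' [_ -> lu']] := finite_path_word wq.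
by apply: muex; apply/count_vertex_perm; rewrite -lu -lu'.
Qed.

Lemma is_muP (R : realType) (d : nat -> R)
    (mu : probability borel_path_space R) :
  is_mu d mu <-> forall w, mu (word_set w) = (\prod_(i <- w) d i)%:E.
Proof.
split=> [[_ mud] w|mud].
  have [/size0nil ->|w0] := posnP (size w).
    by rewrite word_set_nil probability_setT big_nil.
  have [v [p [vp <- lw]]] := word_finite_path w0.
  by rewrite mud // lw vertex_weight_word.
split; first by apply/tail_invariantP; exact: product_exchangeable mud.
move=> v p /finite_path_word [w [_ -> ->]].
by rewrite mud vertex_weight_word.
Qed.

(** The sets of the paths that start with a given letter partition the space. *)
Lemma letter_probability_vector (R : realType)
    (nu : probability borel_path_space R) :
  probability_vector (fun i => fine (nu (word_set [:: i]))).
Proof.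
split=> [i|]; first exact: fine_ge0.
rewrite -[RHS](@probability_setT _ _ _ nu) -word_set_nil.
rewrite [RHS](measure_word_rcons nu [::]); apply: eq_eseriesr => i _.
by rewrite fineK // fin_num_measure //; exact: measurable_word_set.
Qed.

Theorem theorem5p10 (R : realType) :
  (forall d : nat -> R, probability_vector d ->
     exists mu : probability borel_path_space R,
       is_mu d mu /\
       forall nu : probability borel_path_space R, is_mu d nu ->
         forall A : set borel_path_space, measurable A -> nu A = mu A) /\
  (forall nu : probability borel_path_space R,
     (tail_invariant nu /\ ergodic nu) <->
     (exists d : nat -> R, probability_vector d /\ is_mu d nu)).
Proof.
split=> [d dp|nu].
  have [mu mud] := product_measure_exists dp.
  exists mu; split=> [|nu /is_muP nud A mA]; first exact/is_muP.
  by apply: (measure_eq_words _ mA) => w; rewrite [LHS]nud [RHS]mud.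
split=> [[/tail_invariantP nuex nuerg]|[d [dp numu]]].
  exists (fun i => fine (nu (word_set [:: i]))).
  split; first exact: letter_probability_vector.
  by apply/is_muP; exact: ergodic_product.
split; first by case: numu.
by move/is_muP : numu; exact: product_ergodic.
Qed.
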